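(* Let $p(\cdot):\mathbb{R}^2\to[1,\infty)$ be a continuous function with $1<p_-<p_+<\infty$. Then there exist constants $C>0$, $\varepsilon>0$ and $N_0>1$, all independent of $N$ (they may depend on $p(\cdot)$), such that for every $N\ge N_0$ for which the Kakeya (Nikodym) maximal operator $K_N$ is bounded from $L^{p(\cdot)}(\mathbb{R}^2)$ to $L^{p(\cdot)}(\mathbb{R}^2)$, one has $$\|K_N\|_{L^{p(\cdot)}(\mathbb{R}^2)\to L^{p(\cdot)}(\mathbb{R}^2)}\ge C N^{\varepsilon}.$$
   Context: For a measurable function $p(\cdot):\mathbb{R}^2\to[1,\infty)$, write $p_-=\operatorname{ess\,inf}_{x\in\mathbb{R}^2}p(x)$ and $p_+=\operatorname{ess\,sup}_{x\in\mathbb{R}^2}p(x)$. The variable Lebesgue space $L^{p(\cdot)}(\mathbb{R}^2)$ is the set of measurable functions $f$ such that $\rho_{p(\cdot)}(f/\lambda)=\int_{\mathbb{R}^2}\left(|f(x)|/\lambda\right)^{p(x)}\,dx<\infty$ for some $\lambda>0$, with norm $\|f\|_{L^{p(\cdot)}(\mathbb{R}^2)}=\inf\{\lambda>0:\rho_{p(\cdot)}(f/\lambda)\le 1\}$. For a real number $N>1$, $\mathcal{B}_N$ denotes the set of all rectangles in $\mathbb{R}^2$ (of arbitrary size, position and orientation) with eccentricity $N$, i.e. for which the ratio of the length of the long sides to that of the short sides equals $N$. For a locally integrable function $f$ on $\mathbb{R}^2$, the Kakeya (Nikodym) maximal operator is $$K_Nf(x)=\sup_{x\in R\in\mathcal{B}_N}\frac{1}{|R|}\int_R|f(y)|\,dy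 .$$ $\|K_N\|_{L^{p(\cdot)}(\mathbb{R}^2)\to L^{p(\cdot)}(\mathbb{R}^2)}$ is the operator norm, i.e. the smallest constant $A$ such that $\|K_Nf\|_{L^{p(\cdot)}(\mathbb{R}^2)}\le A\|f\|_{L^{p(\cdot)}(\mathbb{R}^2)}$ for all $f\in L^{p(\cdot)}(\mathbb{R}^2)$. *)

(* Defs.v *)
From HB Require Import structures.
From mathcomp Require Import all_boot all_order all_algebra.
From mathcomp Require Import all_classical all_reals all_analysis measurable_realfun.

Set Implicit Arguments.
Unset Strict Implicit.
Unset Printing Implicit Defensive.

Import Order.TTheory GRing.Theory Num.Theory.
Import numFieldNormedType.Exports.

Local Open Scope classical_set_scope.
Local Open Scope ring_scope.
Local Open Scope ereal_scope.

(* Two-dimensional Lebesgue measure, on the Borel sets of the plane. *)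
Notation mu2 R := (@lebesgue_measure R \x @lebesgue_measure R)%E.

(* Lebesgue (not just Borel) measurability: preimages lie in the completion
   of the Borel sigma-algebra.  The integral of the library is a supremum over
   simple functions below the integrand, so for nonnegative integrands of this
   kind it is the usual Lebesgue integral although mu2 lives on Borel sets. *)
Definition lebesgue_measurable_fun (R : realType) (f : R * R -> \bar R) : Prop :=
  forall B : set (\bar R), measurable B ->
    completed_algebra_gen (mu2 R) (f @^-1` B).

Definition modular (R : realType) (p : R * R -> R) (f : R * R -> \bar R) : \bar R :=
  \int[mu2 R]_x (`|f x| `^ p x).

Definition in_Lp (R : realType) (p : R * R -> R) (f : R * R -> \bar R) : Prop :=
  lebesgue_measurable_fun f /\
  exists2 l : R, (0 < l)%R & modular p (fun x => f x * (l^-1)%:E) < +oo.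

Definition Lp_norm (R : realType) (p : R * R -> R) (f : R * R -> \bar R) : \bar R :=
  ereal_inf [set l%:E | l in
    [set l : R | (0 < l)%R /\ modular p (fun x => f x * (l^-1)%:E) <= 1]].

(* The closed rectangle with a vertex c and sides of length a in the direction
   of the unit vector u and b in the orthogonal direction (- u.2, u.1). *)
Definition rectangle (R : realType) (c u : R * R) (a b : R) : set (R * R) :=
  [set x | exists s t : R, [/\ (0 <= s <= a)%R, (0 <= t <= b)%R &
    x = (c.1 + s * u.1 - t * u.2, c.2 + s * u.2 + t * u.1)%R]].

Definition eccentric_rectangles (R : realType) (N : R) : set (set (R * R)) :=
  [set Q | exists (c u : R * R) (long short : R),
    [/\ (u.1 ^+ 2 + u.2 ^+ 2 = 1)%R, (0 < short)%R, (long / short = N)%R &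
        Q = rectangle c u long short]].

Definition kakeya (R : realType) (N : R) (f : R * R -> \bar R) (x : R * R) : \bar R :=
  ereal_sup [set (mu2 R Q)^-1 * \int[mu2 R]_(y in Q) `|f y| | Q in
    [set Q | eccentric_rectangles N Q /\ Q x]].

Definition Lp_bound (R : realType) (p : R * R -> R)
    (T : (R * R -> \bar R) -> R * R -> \bar R) (A : R) : Prop :=
  (0 <= A)%R /\
  forall f, in_Lp p f -> Lp_norm p (T f) <= A%:E * Lp_norm p f.

Definition Lp_bounded (R : realType) (p : R * R -> R)
    (T : (R * R -> \bar R) -> R * R -> \bar R) : Prop :=
  (forall f, in_Lp p f -> in_Lp p (T f)) /\ exists A : R, Lp_bound p T A.

Definition Lp_opnorm (R : realType) (p : R * R -> R)
    (T : (R * R -> \bar R) -> R * R -> \bar R) : \bar R :=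
  ereal_inf [set A%:E | A in [set A : R | Lp_bound p T A]].

(* Main.v *)
Require Import Defs.
From HB Require Import structures.
From mathcomp Require Import all_boot all_order all_algebra.
From mathcomp Require Import all_classical all_reals all_analysis ess_sup_inf.
From mathcomp Require Import measurable_realfun lra ring.
Set Implicit Arguments.
Unset Strict Implicit.
Unset Printing Implicit Defensive.

Import Order.TTheory GRing.Theory Num.Theory.
Import numFieldNormedType.Exports.
Local Open Scope classical_set_scope.
Local Open Scope ring_scope.

(** Why the norm grows.  If the exponent p takes two different values at the ends
    of a segment of length L, then p <= q1 near one point of the segment and
    p >= q2 near another, for some q1 < q2.  Take the rectangle Q of length L
    and width L / N along the segment, and let E and F be its slices of a fixed
    length d close to these two points.  The average of the indicator of E over
    Q is d / L, whatever N is, so the maximal function of that indicator is at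
    least d / L on F.  Both slices have the same measure m = d L / N, which is
    small; a set of small measure m has an indicator of norm at most
    m ^ (1 / q1) where the exponent is at most q1, and at least m ^ (1 / q2)
    where it is at least q2.  Hence every bound A for the operator satisfies
    A >= (d / L) m ^ (1 / q2 - 1 / q1), and the right-hand side is a constant
    times N ^ (1 / q1 - 1 / q2).  This is [Lp_bound_kakeya_ge] (the comparison
    of norms) and [kakeya_growth_on_segment] (the choice of Q, E and F).

    The segment can be taken parallel to an axis: a nonconstant function of the
    plane already changes along a horizontal or a vertical line.  Then all three
    rectangles are products of intervals, whose area is a product of lengths. *)

(** * Norms of indicators in a variable Lebesgue space *)

(** The integral of a nonnegative function is the supremum of the integrals of
    the simple functions below it, so it is monotone for arbitrary functions.
    This applies to a maximal function, a supremum over uncountably many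
    rectangles, without a study of its measurability. *)
Lemma le_integral_ge0 d (T : measurableType d) (R : realType)
    (mu : {measure set T -> \bar R}) (f g : T -> \bar R) :
  (forall x, 0 <= f x)%E -> (forall x, f x <= g x)%E ->
  (\int[mu]_x f x <= \int[mu]_x g x)%E.
Proof.
move=> f0 fg; have g0 x : (0 <= g x)%E by exact: le_trans (fg x).
rewrite !ge0_integralTE//; apply: ereal_sup_le => _ [h /= hf <-].
by exists h => // x; exact: le_trans (fg x).
Qed.

Section variable_norms.
Context {R : realType}.
Local Notation plane := (measurableTypeR R * measurableTypeR R)%type.
Implicit Types (p : R * R -> R) (E F Q : set plane) (f : R * R -> \bar R).

Lemma integral_scaled_indic E (k : R) : measurable E -> 0 <= k ->
  (\int[mu2 R]_x (k * \1_E x)%:E = k%:E * mu2 R E)%E.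
Proof.
move=> mE k0.
transitivity (k%:E * \int[mu2 R]_x (\1_E x)%:E)%E; last by rewrite integral_indic// setIT.
by apply: (integralZl_indic measurableT (fun=> E)) => //; rewrite ltNge k0.
Qed.

Lemma modular_le_on p f E (k : R) : measurable E -> 0 <= k ->
  (forall x, E x -> `|f x| `^ p x <= k%:E)%E ->
  (forall x, ~ E x -> `|f x| `^ p x = 0)%E ->
  (modular p f <= k%:E * mu2 R E)%E.
Proof.
move=> mE k0 fE fNE; rewrite -integral_scaled_indic//.
apply: le_integral_ge0 => x; first exact: poweR_ge0.
rewrite indicE; have [/set_mem /fE|/negP] := boolP (x \in E); first by rewrite mulr1.
by rewrite mulr0 inE => /fNE ->.
Qed.

Lemma modular_ge_on p f E (k : R) : measurable E -> 0 <= k ->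
  (forall x, E x -> k%:E <= `|f x| `^ p x)%E ->
  (k%:E * mu2 R E <= modular p f)%E.
Proof.
move=> mE k0 fE; rewrite -integral_scaled_indic//.
apply: le_integral_ge0 => x; first by rewrite lee_fin mulr_ge0.
rewrite indicE; have [/set_mem /fE|_] := boolP (x \in E); first by rewrite mulr1.
by rewrite mulr0 poweR_ge0.
Qed.

Lemma modular_indic_le p E (q m l : R) : measurable E -> (forall x, 0 < p x) ->
  (forall x, E x -> p x <= q) -> mu2 R E = m%:E -> 1 <= l ->
  (modular p (fun x => (\1_E x)%:E * l%:E) <= (l `^ q * m)%:E)%E.
Proof.
move=> mE p0 pq Em l1; rewrite EFinM -Em; apply: modular_le_on => //.
- exact: powR_ge0.
- move=> x Ex; rewrite indicE mem_set// mul1e abse_EFin poweR_EFin lee_fin.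
  by rewrite ger0_norm ?(le_trans _ l1)// ler_powR// pq.
- move=> x NEx; rewrite indicE memNset// mul0e abse0 poweR0r//.
  by rewrite gt_eqF.
Qed.

Lemma in_Lp_indic p E (q m : R) : measurable E -> (forall x, 0 < p x) ->
  (forall x, E x -> p x <= q) -> mu2 R E = m%:E -> in_Lp p (EFin \o \1_E).
Proof.
move=> mE p0 pq Em; split.
  move=> B mB; exists ((EFin \o \1_E) @^-1` B); last first.
    by exists set0; [exact: negligible_set0|rewrite setU0].
  have mf : measurable_fun [set: plane] (EFin \o (\1_E : plane -> R)).
    by apply/measurable_EFinP; exact: measurable_indic.
  by have := mf measurableT B mB; rewrite setTI.
exists 1 => //; rewrite invr1.
by apply: le_lt_trans (modular_indic_le mE p0 pq Em (lexx 1)) _; rewrite ltry.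
Qed.

Lemma powR_inv_le1 (m q : R) : 0 < m <= 1 -> 0 < q -> m `^ q^-1 <= 1.
Proof. by move=> m01 q0; rewrite -(powRr0 m) ger_powR// invr_ge0 ltW. Qed.

(** As m <= 1, the scale l = m ^ (1 / q) is at most 1, so raising 1 / l to the
    power p x <= q gives at most 1 / m, which integrates to 1 over E. *)
Lemma Lp_norm_indic_le p E (q m : R) : measurable E -> (forall x, 0 < p x) ->
  0 < q -> (forall x, E x -> p x <= q) -> mu2 R E = m%:E -> 0 < m <= 1 ->
  (Lp_norm p (EFin \o \1_E) <= (m `^ q^-1)%:E)%E.
Proof.
move=> mE p0 q0 pq Em /andP[m0 m1]; apply: ge_ereal_inf.
exists (m `^ q^-1)%:E => //; exists (m `^ q^-1) => //=; split; first exact: powR_gt0.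
rewrite -powRN; apply: le_trans (modular_indic_le mE p0 pq Em _) _.
  by rewrite powRN invf_ge1 ?powR_gt0// powR_inv_le1// m0.
rewrite -powRrM mulNr mulVf ?gt_eqF// powR_inv1 ?(ltW m0)//.
by rewrite mulVf ?gt_eqF.
Qed.

(** A scale l < c m ^ (1 / q) is not admissible: c / l exceeds m ^ (- 1 / q),
    which is at least 1, so the power p x >= q of |f x| / l exceeds 1 / m all
    over F and the modular exceeds 1. *)
Lemma Lp_norm_ge p f F (q m c : R) : measurable F ->
  0 < q -> (forall x, F x -> q <= p x) -> mu2 R F = m%:E -> 0 < m <= 1 ->
  0 < c -> (forall x, F x -> c%:E <= `|f x|)%E ->
  ((c * m `^ q^-1)%:E <= Lp_norm p f)%E.
Proof.
move=> mF q0 qp Fm /andP[m0 m1] c0 cf.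
apply: le_ereal_inf_tmp => _ [l [l0 fl] <-]; rewrite lee_fin leNgt.
apply/negP => llt; move: fl; apply/negP; rewrite -ltNge.
have M0 : 0 < m `^ q^-1 by exact: powR_gt0.
have M1 : m `^ q^-1 <= 1 by rewrite powR_inv_le1// m0.
have Mcl : (m `^ q^-1)^-1 < c / l.
  by rewrite ltr_pdivlMr// mulrC ltr_pdivrMr.
have cl1 : 1 <= c / l by apply/ltW/(le_lt_trans _ Mcl); rewrite invf_ge1.
apply: (@lt_le_trans _ _ (((c / l) `^ q)%:E * mu2 R F)%E); last first.
  apply: modular_ge_on => //; first exact: powR_ge0.
  move=> x Fx; apply: (@le_trans _ _ ((c / l) `^ p x)%:E).
    by rewrite lee_fin ler_powR// qp.
  rewrite -poweR_EFin; apply: gt0_ler_poweR.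
  - by rewrite (le_trans (ltW q0))// qp.
  - by rewrite in_itv/= leey lee_fin divr_ge0// ltW.
  - by rewrite in_itv/= leey abse_ge0.
  - rewrite abseM EFinM [(`|_%:E|)%E]abse_EFin gtr0_norm ?invr_gt0//.
    by rewrite lee_wpmul2r ?cf// lee_fin invr_ge0 ltW.
rewrite Fm -EFinM lte_fin -ltr_pdivrMr// div1r.
have -> : m^-1 = ((m `^ q^-1)^-1) `^ q.
  by rewrite -powRN -powRrM mulNr mulVf ?gt_eqF// powR_inv1// ltW.
by apply: gt0_ltr_powR => //; rewrite nnegrE ltW ?invr_gt0// divr_gt0.
Qed.

(** * Testing the maximal operator on an indicator *)

Lemma kakeya_indic_ge (N : R) E Q (m M : R) x : measurable E ->
  eccentric_rectangles N Q -> E `<=` Q -> Q x ->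
  mu2 R E = m%:E -> mu2 R Q = M%:E -> 0 < M ->
  ((m / M)%:E <= kakeya N (EFin \o \1_E) x)%E.
Proof.
move=> mE NQ EQ Qx Em QM M0; apply: le_ereal_sup_tmp.
eexists; first by exists Q => //; split.
rewrite QM inver gt_eqF// mulrC EFinM lee_pmul2l// ?lte_fin ?invr_gt0//.
rewrite integral_mkcond -Em -[E in leLHS]setIT -integral_indic//.
apply: le_integral_ge0 => y; first by rewrite lee_fin indicE.
rewrite /patch indicE; have [Ey|_] := boolP (y \in E); last first.
  by case: ifP => _; rewrite ?abse_ge0.
have yQ : y \in Q by apply/mem_set/EQ/set_mem.
by rewrite yQ/= indicE Ey normr1.
Qed.

(** Testing the bound A on the indicator of E: the norm of the test function is
    at most m ^ (1 / q1), whereas its maximal function is at least m / M on F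
    and so has norm at least (m / M) m ^ (1 / q2).  When q1 < q2 the exponent
    1 / q2 - 1 / q1 is negative, so that small sets give large lower bounds. *)
Lemma Lp_bound_kakeya_ge p (N : R) E F Q (q1 q2 m M A : R) :
  (forall x, 0 < p x) -> measurable E -> measurable F ->
  eccentric_rectangles N Q -> E `<=` Q -> F `<=` Q ->
  mu2 R E = m%:E -> mu2 R F = m%:E -> mu2 R Q = M%:E -> 0 < m <= 1 -> 0 < M ->
  0 < q1 -> 0 < q2 ->
  (forall x, E x -> p x <= q1) -> (forall x, F x -> q2 <= p x) ->
  Lp_bound p (kakeya N) A -> m / M * m `^ (q2^-1 - q1^-1) <= A.
Proof.
move=> p0 mE mF NQ EQ FQ Em Fm QM m01 M0 q10 q20 pE pF [A0 KA].
have /andP[m0 _] := m01.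
have /KA : in_Lp p (EFin \o \1_E) by exact: in_Lp_indic pE Em.
have low : ((m / M * m `^ q2^-1)%:E <= Lp_norm p (kakeya N (EFin \o \1_E)))%E.
  apply: (Lp_norm_ge mF q20 pF Fm m01); first exact: divr_gt0.
  move=> x /FQ Qx; have le_K := kakeya_indic_ge mE NQ EQ Qx Em QM M0.
  rewrite gee0_abs//; apply: le_trans le_K.
  by rewrite lee_fin divr_ge0// ltW.
move=> /(le_trans low) h.
have : ((m / M * m `^ q2^-1)%:E <= (A * m `^ q1^-1)%:E)%E.
  apply: (le_trans h); rewrite EFinM lee_wpmul2l ?lee_fin//.
  exact: Lp_norm_indic_le pE Em m01.
rewrite lee_fin powRB; last by rewrite (gt_eqF m0) implybT.
by rewrite mulrA ler_pdivrMr// powR_gt0.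
Qed.

End variable_norms.

(** * Rectangles parallel to the axes *)

Section axis_rectangles.
Context {R : realType}.
Implicit Types (c u : R * R) (a b : R).

Definition axis_direction (u : R * R) := u = (1, 0) \/ u = (0, 1).

Lemma rectangle_horizontal c a b :
  rectangle c (1, 0) a b = `[c.1, c.1 + a] `*` `[c.2, c.2 + b].
Proof.
apply/seteqP; split => [_ [s [t [/andP[s0 sa] /andP[t0 tb] ->]]]|[x y]] /=.
  by rewrite !in_itv/=; split; apply/andP; split; lra.
rewrite !in_itv/= => -[/andP[h1 h2] /andP[h3 h4]].
exists (x - c.1), (y - c.2); split; try (apply/andP; split; lra).
by congr pair => /=; ring.
Qed.

Lemma rectangle_vertical c a b :
  rectangle c (0, 1) a b = `[c.1 - b, c.1] `*` `[c.2, c.2 + a].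
Proof.
apply/seteqP; split => [_ [s [t [/andP[s0 sa] /andP[t0 tb] ->]]]|[x y]] /=.
  by rewrite !in_itv/=; split; apply/andP; split; lra.
rewrite !in_itv/= => -[/andP[h1 h2] /andP[h3 h4]].
exists (y - c.2), (c.1 - x); split; try (apply/andP; split; lra).
by congr pair => /=; ring.
Qed.

Lemma measurable_rectangle c u a b :
  axis_direction u -> measurable (rectangle c u a b).
Proof.
by case=> ->; rewrite ?rectangle_horizontal ?rectangle_vertical;
  apply: measurableX; exact: measurable_itv.
Qed.

Lemma mu2_box (x x' y y' : R) : x < x' -> y < y' ->
  mu2 R (`[x, x'] `*` `[y, y']) = ((x' - x) * (y' - y))%:E.
Proof.
move=> xx' yy'.
transitivity (@lebesgue_measure R `[x, x'] * @lebesgue_measure R `[y, y'])%E.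
  by apply: product_measure1E; exact: measurable_itv.
by rewrite !lebesgue_measure_itv/= !lte_fin xx' yy' -!EFinB -EFinM.
Qed.

Lemma mu2_rectangle c u a b : axis_direction u -> 0 < a -> 0 < b ->
  mu2 R (rectangle c u a b) = (a * b)%:E.
Proof.
move=> + a0 b0; case=> ->; rewrite ?rectangle_horizontal ?rectangle_vertical.
  by rewrite mu2_box ?ltrDl//; congr EFin; ring.
by rewrite mu2_box ?ltrDl ?gtrBl//; congr EFin; ring.
Qed.

Definition along (c u : R * R) (s : R) : R * R := (c.1 + s * u.1, c.2 + s * u.2).

Lemma along0 c u : along c u 0 = c.
Proof. by case: c => x y; rewrite /along !mul0r !addr0. Qed.

Lemma alongD c u s t : along (along c u s) u t = along c u (s + t).
Proof. by rewrite /along/=; congr pair; ring. Qed.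

Lemma rectangle_sub_ball c u a b (s r : R) : axis_direction u ->
  0 <= s <= a -> a < r -> b < r -> rectangle c u a b `<=` ball (along c u s) r.
Proof.
move=> Au /andP[s_ge0 sa] ar br _ [s' [t [/andP[s'0 s'a] /andP[t0 tb] ->]]].
by split; rewrite /ball/= ltr_distlC; apply/andP; split;
  case: Au => -> /=; lra.
Qed.

Lemma subrectangle c u a a' b (s : R) : 0 <= s -> s + a' <= a ->
  rectangle (along c u s) u a' b `<=` rectangle c u a b.
Proof.
move=> s_ge0 sa _ [s' [t [/andP[hs sa'] ht ->]]]; exists (s + s'), t.
split => //=; first by apply/andP; split; lra.
by congr pair; ring.
Qed.

(** A point of the long axis that is closer than d to the far end cannot be the
    starting point of a slice of length d; the slice is then pushed back until
    it ends at the far end, and it still contains the point. *)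
Lemma slice_near c u L d h (s r : R) : axis_direction u ->
  0 <= s <= L -> 0 < d <= L -> d < r -> h < r ->
  exists2 c', rectangle c' u d h `<=` rectangle c u L h &
    rectangle c' u d h `<=` ball (along c u s) r.
Proof.
move=> Au /andP[s0 sL] /andP[d0 dL] dr hr.
have [t [t0 tdL ts std]] :
    exists t : R, [/\ 0 <= t, t + d <= L, t <= s & s <= t + d].
  by case: (leP s (L - d)) => ?; [exists s|exists (L - d)]; split; lra.
exists (along c u t); first exact: subrectangle.
have -> : along c u s = along (along c u t) u (s - t) by rewrite alongD subrKC.
by apply: rectangle_sub_ball => //; apply/andP; split; lra.
Qed.

End axis_rectangles.

(** * Growth of the norm *)

(** The constants come from d, the length of the slices E and F, and from the
    radius r of balls where p <= q1 and p >= q2.  The width L / N must be below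
    r, and the area d L / N of the slices at most 1: this is what the lower
    bound on N provides. *)
Lemma kakeya_growth_on_segment {R : realType} (p : R * R -> R) (c u : R * R)
    (L s1 s2 : R) :
  continuous p -> (forall x, 0 < p x) -> axis_direction u ->
  0 < L -> 0 <= s1 <= L -> 0 <= s2 <= L ->
  p (along c u s1) < p (along c u s2) ->
  exists C eps N0 : R, [/\ 0 < C, 0 < eps, 1 < N0 &
    forall N A : R, N0 <= N -> Lp_bound p (kakeya N) A -> C * N `^ eps <= A].
Proof.
move=> cp p0 Au L0 s1L s2L.
set x1 := along c u s1; set x2 := along c u s2 => p12.
pose q1 := (2 * p x1 + p x2) / 3; pose q2 := (p x1 + 2 * p x2) / 3.
have p10 := p0 x1.
have q10 : 0 < q1 by rewrite /q1; lra.
have q12 : q1 < q2 by rewrite /q1 /q2; lra.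
have q20 : 0 < q2 by exact: lt_trans q12.
have [r1 /= r10 pr1] : exists2 r, 0 < r & ball x1 r `<=` [set x | p x <= q1].
  apply/nbhs_ballP; near=> x; apply/ltW; near: x.
  by apply: (cvgr_lt (p x1) (cp x1)); rewrite /q1; lra.
have [r2 /= r20 pr2] : exists2 r, 0 < r & ball x2 r `<=` [set x | q2 <= p x].
  apply/nbhs_ballP; near=> x; apply/ltW; near: x.
  by apply: (cvgr_gt (p x2) (cp x2)); rewrite /q2; lra.
pose r := Num.min r1 r2.
have r0 : 0 < r by rewrite lt_min r10.
pose d := Num.min (r / 2) L.
have d0 : 0 < d by rewrite lt_min L0 divr_gt0.
have dr : d < r by rewrite gt_min; apply/orP; left; lra.
have dL : d <= L by rewrite ge_min lexx orbT.
pose eps := q1^-1 - q2^-1.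
exists (d / L * (d * L) `^ (- eps)), eps, (2 + d * L + L / r); split.
- by rewrite mulr_gt0 ?divr_gt0// powR_gt0// mulr_gt0.
- by rewrite subr_gt0 ltf_pV2.
- have : 0 < L / r by exact: divr_gt0.
  have : 0 < d * L by exact: mulr_gt0.
  lra.
move=> N A NN0 NA.
have Lr0 : 0 < L / r by exact: divr_gt0.
have dL0 : 0 < d * L by exact: mulr_gt0.
have N0 : 0 < N by lra.
pose h := L / N.
have h0 : 0 < h by exact: divr_gt0.
have hr : h < r by rewrite /h ltr_pdivrMr// mulrC -ltr_pdivrMr//; lra.
have d0L : 0 < d <= L by rewrite d0.
have [c1 sub1 near1] := slice_near c Au s1L d0L dr hr.
have [c2 sub2 near2] := slice_near c Au s2L d0L dr hr.
have dh : d * h = d * L / N by rewrite /h mulrA.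
have := @Lp_bound_kakeya_ge R p N (rectangle c1 u d h) (rectangle c2 u d h)
  (rectangle c u L h) q1 q2 (d * h) (L * h) A p0.
have -> : d * h / (L * h) = d / L by field; rewrite !gt_eqF.
have -> : (d * h) `^ (q2^-1 - q1^-1) = (d * L) `^ (- eps) * N `^ eps.
  rewrite dh /eps opprB powRM ?invr_ge0 1?ltW//; congr (_ * _).
  by rewrite -powR_inv1 1?ltW// -powRrM mulN1r opprB.
rewrite mulrA; apply => //.
- exact: measurable_rectangle.
- exact: measurable_rectangle.
- exists c, u, L, h; split => //; last by rewrite /h; field; rewrite !gt_eqF.
  by case: Au => -> /=; ring.
- exact: mu2_rectangle.
- exact: mu2_rectangle.
- exact: mu2_rectangle.
- rewrite mulr_gt0//= dh ler_pdivrMr//; lra.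
- exact: mulr_gt0.
- by move=> x /near1 xr; apply: pr1; apply: le_ball xr; rewrite ge_min lexx.
- by move=> x /near2 xr; apply: pr2; apply: le_ball xr; rewrite ge_min lexx orbT.
Unshelve. all: by end_near. Qed.

(** The displacement t may have either sign, and p may be larger at either end;
    so the segment is based at whichever end has the smaller parameter, and s1,
    s2 are the positions of the two ends on it. *)
Lemma kakeya_growth_along {R : realType} (p : R * R -> R) (x u : R * R) (t : R) :
  continuous p -> (forall x, 0 < p x) -> axis_direction u ->
  p x != p (along x u t) ->
  exists C eps N0 : R, [/\ 0 < C, 0 < eps, 1 < N0 &
    forall N A : R, N0 <= N -> Lp_bound p (kakeya N) A -> C * N `^ eps <= A].
Proof.
move=> cp p0 Au pxt.
have t0 : 0 < `|t|.
  by rewrite normr_gt0; apply: contraNneq pxt => ->; rewrite along0.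
pose s1 := Num.max 0 (- t); pose s2 := Num.max 0 t.
have s1t : 0 <= s1 <= `|t|.
  by rewrite /s1 le_max lexx/= ge_max normr_ge0 -normrN ler_norm.
have s2t : 0 <= s2 <= `|t|.
  by rewrite /s2 le_max lexx/= ge_max normr_ge0 ler_norm.
pose c := along x u (- s1).
have e1 : along c u s1 = x by rewrite alongD addNr along0.
have e2 : along c u s2 = along x u t.
  rewrite alongD; congr along; rewrite /s1 /s2 !maxElt.
  by case: (ltP 0 t) => ?; case: (ltP 0 (- t)) => ?; lra.
case: (ltgtP (p x) (p (along x u t))) pxt => // pxt _.
  by apply: (@kakeya_growth_on_segment _ p c u `|t| s1 s2) => //; rewrite e1 e2.
by apply: (@kakeya_growth_on_segment _ p c u `|t| s2 s1) => //; rewrite e1 e2.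
Qed.

Lemma mu2_setT_gt0 (R : realType) : (0 < mu2 R setT)%E.
Proof.
have A1 : axis_direction ((1, 0) : R * R) by left.
apply: (@lt_le_trans _ _ (mu2 R (rectangle (0, 0) (1, 0) 1 1))).
  by rewrite mu2_rectangle// lte_fin mulr1.
by apply: le_measure => //; rewrite inE//; exact: measurable_rectangle.
Qed.

Theorem theorem1p3 (R : realType) (p : R * R -> R)
  (p_ge1 : forall x, 1 <= p x)
  (p_cont : continuous p)
  (p_inf_gt1 : (1 < ess_inf (mu2 R) (EFin \o p))%E)
  (p_inf_lt_sup :
    (ess_inf (mu2 R) (EFin \o p) < ess_sup (mu2 R) (EFin \o p))%E)
  (p_sup_fin : (ess_sup (mu2 R) (EFin \o p) < +oo)%E) :
  exists C eps N0 : R, [/\ 0 < C, 0 < eps, 1 < N0 &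
    forall N : R, N0 <= N -> Lp_bounded p (kakeya N) ->
      ((C * N `^ eps)%:E <= Lp_opnorm p (kakeya N))%E].
Proof.
have p0 x : 0 < p x by exact: lt_le_trans (p_ge1 x).
suff [C [eps [N0 [C0 eps0 N01 CN]]]] : exists C eps N0 : R,
    [/\ 0 < C, 0 < eps, 1 < N0 & forall N A : R, N0 <= N ->
      Lp_bound p (kakeya N) A -> C * N `^ eps <= A].
  exists C, eps, N0; split => // N NN0 _.
  by apply: le_ereal_inf_tmp => _ [A KA <-]; rewrite lee_fin CN.
have [x [y pxy]] : exists x y, p x != p y.
  apply/not_existsP => pcst; move: p_inf_lt_sup; apply/negP; rewrite -leNgt.
  have -> : EFin \o p = cst (p 0)%:E.
    apply/funext => x /=; congr EFin; apply/eqP/negPn/negP => px.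
    by apply: (pcst x); exists 0.
  by rewrite ess_inf_cst ?ess_sup_cst//; exact: mu2_setT_gt0.
(* Go from x to y through a corner, first horizontally, then vertically. *)
have [pxz|pxz] := eqVneq (p x) (p (y.1, x.2)); last first.
  apply: (@kakeya_growth_along _ p x (1, 0) (y.1 - x.1)) => //; first by left.
  by rewrite /along/= mulr1 mulr0 addr0 subrKC.
apply: (@kakeya_growth_along _ p (y.1, x.2) (0, 1) (y.2 - x.2)) => //.
  by right.
by rewrite -pxz /along/= mulr1 mulr0 addr0 subrKC -surjective_pairing.
Qed.
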